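(* Let $n\ge 2$, $r>n-1$, let $\tilde b\in\mathbb{R}^n$ satisfy the Diophantine condition with exponent $r$, and let either $(\mu,\nu)=(1,0)$ or $(\mu,\nu)=(0,1)$. Let $s\ge 0$ and assume that $(U_0,B_0)\in H^s(\mathbb{T}^n)$ satisfies $$\int_{\mathbb{T}^n}U_0\,dx=0\quad\text{and}\quad \int_{\mathbb{T}^n}B_0\,dx=0 .$$ Let $(U,B)$ be the corresponding solution of the linear system $$\begin{cases}\partial_t U-\mu\Delta U=\tilde b\cdot\nabla B,\\ \partial_t B-\nu\Delta B=\tilde b\cdot\nabla U,\\ \nabla\cdot U=\nabla\cdot B=0,\\ U(x,0)=U_0(x),\ B(x,0)=B_0(x),\end{cases}$$ on $\mathbb{T}^n\times[0,\infty)$. Then for any $0\le\alpha\le s$ there is a constant $C>0$, independent of $t$ and of $(U_0,B_0)$, such that for all $t\ge 0$ $$\|U(t)\|_{H^\alpha(\mathbb{T}^n)}+\|B(t)\|_{H^\alpha(\mathbb{T}^n)}\le C(1+t)^{-\frac{s-\alpha}{2(1+r)}}\left(\|U_0\|_{H^s(\mathbb{T}^n)}+\|B_0\|_{H^s(\mathbb{T}^n)}\right).$$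
   Context: $\mathbb{T}^n$ is the $n$-dimensional periodic domain (torus) with Fourier frequencies $k\in\mathbb{Z}^n$, normalized so that $\Delta$ acts as multiplication by $-|k|^2$. $U,B$ are $\mathbb{R}^n$-valued vector fields (velocity and magnetic field), and the initial data are divergence free, as required by the system. $H^s(\mathbb{T}^n)$ is the usual inhomogeneous Sobolev space. Diophantine condition: a vector $\tilde b\in\mathbb{R}^n$ satisfies the Diophantine condition with exponent $r>n-1$ if there exists a constant $c>0$ such that $|\tilde b\cdot k|\ge \dfrac{c}{|k|^r}$ for every nonzero $k\in\mathbb{Z}^n$. *)

(* Defs.v *)
From HB Require Import structures.
From mathcomp Require Import all_boot all_order all_algebra.
From mathcomp Require Import complex.
From mathcomp Require Import all_classical all_reals all_analysis.

Set Implicit Arguments.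
Unset Strict Implicit.
Unset Printing Implicit Defensive.

Import Order.TTheory GRing.Theory Num.Theory.
Import numFieldNormedType.Exports.

Local Open Scope classical_set_scope.
Local Open Scope ring_scope.

Section frequencies.
Context {R : realType} {n : nat}.

(* The library norm on row vectors is the sup norm, so the Euclidean dot
   product and norm are spelled out. *)
Definition dot (x y : 'rV[R]_n) : R := \sum_(i < n) x 0 i * y 0 i.

Definition freq (k : 'rV[int]_n) : 'rV[R]_n := map_mx intr k.

Definition enorm (x : 'rV[R]_n) : R := Num.sqrt (dot x x).

Definition diophantine (b : 'rV[R]_n) (r : R) : Prop :=
  exists2 c : R, 0 < c &
    forall k : 'rV[int]_n, k != 0 -> c / enorm (freq k) `^ r <= `|dot b (freq k)|.

End frequencies.

(* The torus is (R / 2 pi Z)^n, so that the exponentials exp(i k.x), k in Z^n,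
   are its characters and the Laplacian multiplies them by -|k|^2.  Measurable
   functions on it are represented by functions on R^n considered almost
   everywhere on [0, 2 pi]^n, for the normalized measure (2 pi)^-n dx. *)
Section torus_measure.
Context {R : realType}.

Lemma two_pi_gt0 : 0 < 2 * pi :> R.
Proof. by rewrite mulr_gt0// pi_gt0. Qed.

Definition circle_prob : probability (measurableTypeR R) R :=
  uniform_prob two_pi_gt0.

Definition tpoint (n : nat) := n.-tuple (measurableTypeR R).

Definition cons_tpoint (n : nat) (x : measurableTypeR R * tpoint n) :
  tpoint n.+1 := [tuple of x.1 :: x.2].

Lemma measurable_cons_tpoint n : measurable_fun setT (@cons_tpoint n).
Proof. exact: measurable_cons. Qed.

HB.instance Definition _ n :=
  isMeasurableFun.Build _ _ _ _ (@cons_tpoint n) (@measurable_cons_tpoint n).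

Fixpoint torus_prob (n : nat) : probability (tpoint n) R :=
  match n with
  | 0 => \d_([tuple] : tpoint 0)
  | m.+1 => distribution (circle_prob \x torus_prob m)%E (@cons_tpoint m)
  end.

End torus_measure.

Section fields.
Context {R : realType} {n : nat}.
Local Notation P := (@torus_prob R n).

Definition tfun := tpoint (R := R) n -> R.
Definition vfield := tpoint (R := R) n -> 'rV[R]_n.

Definition component (U : vfield) (i : 'I_n) : tfun := fun x => U x 0 i.

Definition coords (x : tpoint (R := R) n) : 'rV[R]_n := \row_i tnth x i.

(* (2 pi)^-n times the integral of u(x) exp(- i k.x) *)
Definition fourier (u : tfun) (k : 'rV[int]_n) : R[i] :=
  ((\int[P]_x (u x * cos (dot (freq k) (coords x))))
   +i* (- \int[P]_x (u x * sin (dot (freq k) (coords x)))))%C.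

(* Possibly infinite; only meant for fields with components in L^2. *)
Definition Hnorm (s : R) (U : vfield) : \bar R :=
  ((\esum_(k in [set: 'rV[int]_n])
     ((1 + enorm (freq (R := R) k) ^+ 2) `^ s *
      \sum_(i < n) Normc.normc (fourier (component U i) k) ^+ 2)%:E) `^ 2^-1)%E.

Definition L2field (U : vfield) : Prop :=
  forall i, component U i \in Lfun P 2%:E.

(* For s >= 0, H^s is the subspace of L^2 where the H^s norm is finite. *)
Definition Hspace (s : R) (U : vfield) : Prop :=
  L2field U /\ (Hnorm s U < +oo)%E.

Definition mean_zero (U : vfield) : Prop :=
  forall i, \int[P]_x component U i x = 0.

(* Test functions: smooth functions on R^n that are 2 pi-periodic in each
   coordinate. *)
Definition pderiv (j : 'I_n) (phi : 'rV[R]_n -> R) : 'rV[R]_n -> R :=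
  fun x => 'D_(delta_mx 0 j) phi x.

Fixpoint class_C (m : nat) (phi : 'rV[R]_n -> R) : Prop :=
  match m with
  | 0 => continuous phi
  | m'.+1 => continuous phi /\ forall j : 'I_n,
      (forall x, derivable phi x (delta_mx 0 j)) /\ class_C m' (pderiv j phi)
  end.

Definition test_fun (phi : 'rV[R]_n -> R) : Prop :=
  (forall m, class_C m phi) /\
  (forall x (j : 'I_n), phi (x + (2 * pi) *: delta_mx 0 j) = phi x).

Definition laplacian (phi : 'rV[R]_n -> R) : 'rV[R]_n -> R :=
  fun x => \sum_(j < n) pderiv j (pderiv j phi) x.

Definition transport (b : 'rV[R]_n) (phi : 'rV[R]_n -> R) : 'rV[R]_n -> R :=
  fun x => \sum_(j < n) b 0 j * pderiv j phi x.

Definition pairing (u : tfun) (phi : 'rV[R]_n -> R) : R :=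
  \int[P]_x (u x * phi (coords x)).

Definition div_free (U : vfield) : Prop :=
  forall phi, test_fun phi ->
    \sum_(j < n) pairing (component U j) (pderiv j phi) = 0.

(* d/dt U - mu Delta U = b.grad B for t > 0 in the sense of distributions on
   the torus; the minus sign comes from integrating b.grad by parts. *)
Definition weak_eq (mu : R) (b : 'rV[R]_n) (U B : R -> vfield) : Prop :=
  forall (i : 'I_n) phi, test_fun phi -> forall t : R, 0 < t ->
    is_derive t 1 (fun tau : R => pairing (component (U tau) i) phi)
      (mu * pairing (component (U t) i) (laplacian phi)
       - pairing (component (B t) i) (transport b phi)).

Definition weakly_continuous (U : R -> vfield) : Prop :=
  forall (i : 'I_n) phi, test_fun phi ->
    {within `[0, +oo[, continuous (fun t : R => pairing (component (U t) i) phi)}.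

(* Only the values at times t >= 0 matter.  Data are merely in L^2, so the
   equations and the divergence constraints are understood weakly in space. *)
Record solution (mu nu : R) (b : 'rV[R]_n) (U0 B0 : vfield)
    (U B : R -> vfield) : Prop := Solution {
  solution_L2 : forall t : R, 0 <= t -> L2field (U t) /\ L2field (B t);
  solution_continuous : weakly_continuous U /\ weakly_continuous B;
  solution_velocity : weak_eq mu b U B;
  solution_magnetic : weak_eq nu b B U;
  solution_div : forall t : R, 0 <= t -> div_free (U t) /\ div_free (B t);
  solution_init :
    {ae P, forall x, U 0 x = U0 x} /\ {ae P, forall x, B 0 x = B0 x} }.

End fields.

Arguments vfield : clear implicits.

(* Main.v *)
(* Testing the equations against [cos (k.x)] and [sin (k.x)] shows that every
   Fourier mode splits into two damped oscillators
   [x' = w y - m x], [y' = - w x] with [m = |k|^2] and [w = b.k].  A small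
   multiple of [x y] added to [x^2 + y^2] gives a Lyapunov function, hence decay
   at a rate of order [w^2 / m], which the Diophantine condition bounds below by
   a multiple of [|k|^(-2(1+r))].  Trading [|k|^(2(s - alpha))] for decay in
   time and summing over [k] gives the estimate; the mode [k = 0] is conserved
   and vanishes because the data have mean zero. *)
Require Import Defs.
From mathcomp Require Import all_boot all_order all_algebra.
From mathcomp Require Import complex ring lra.
From mathcomp Require Import all_classical all_reals all_analysis.
From mathcomp Require Import measurable_realfun.

Set Implicit Arguments.
Unset Strict Implicit.
Unset Printing Implicit Defensive.

Import Order.TTheory GRing.Theory Num.Theory.
Import numFieldNormedType.Exports.

Local Open Scope classical_set_scope.
Local Open Scope ring_scope.

(** * Decay of a damped oscillator *)

(** Makes the modified energy comparable to [a ^ 2 + c ^ 2]: expand [(1/2 + d) (a +- c) ^ 2 >= 0]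
    and [(1/2 - d) (a +- c) ^ 2 >= 0]. *)
Lemma energy_bounds (R : realType) (d a c : R) : -2^-1 <= d <= 2^-1 ->
  (a ^+ 2 + c ^+ 2) / 2 <= a ^+ 2 + c ^+ 2 - 2 * d * (a * c)
    <= 3 / 2 * (a ^+ 2 + c ^+ 2).
Proof.
move=> /andP[d1 d2].
have dp : 0 <= 2^-1 + d by lra.
have dm : 0 <= 2^-1 - d by lra.
have pp := mulr_ge0 dp (sqr_ge0 (a + c)).
have pm := mulr_ge0 dp (sqr_ge0 (a - c)).
have mp := mulr_ge0 dm (sqr_ge0 (a + c)).
have mm := mulr_ge0 dm (sqr_ge0 (a - c)).
by apply/andP; split; lra.
Qed.

(* With [d = eta w / m], [2 eta (1 + K) = 1], the cross term in the energy
   [a ^ 2 + c ^ 2 - 2 d a c] transfers the damping of [a] to [c]. *)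
Lemma damped_oscillator_lyapunov (R : realType) (K m w : R) :
  0 <= K -> 0 <= m -> w ^+ 2 <= K * m ^+ 2 ->
  exists2 d : R, -2^-1 <= d <= 2^-1 & forall a c : R,
    2 * a * (w * c - m * a) + 2 * c * (- (w * a)) -
      2 * d * ((w * c - m * a) * c + a * (- (w * a))) +
    w ^+ 2 / (4 * (1 + K) * m) * (a ^+ 2 + c ^+ 2 - 2 * d * (a * c)) <= 0.
Proof.
move=> K_ge0 m_ge0 w_le.
(* If [m = 0] then also [w = 0]: the system is stationary, and the rate is [0] because division by
   zero gives [0]. *)
have [m0|mN0] := eqVneq m 0.
  have w0 : w = 0.
    apply/eqP; rewrite -sqrf_eq0 eq_le sqr_ge0 andbT (le_trans w_le)//.
    by rewrite m0 expr0n mulr0.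
  exists 0 => [|a c]; first by lra.
  by rewrite m0 w0 expr0n !mul0r; lra.
have m_gt0 : 0 < m by rewrite lt0r mN0.
have K1_gt0 : 0 < 2 * (1 + K) by clear w_le; lra.
have [eta eta_gt0 eta_eq] : exists2 eta : R, 0 < eta & eta * (2 * (1 + K)) = 1.
  by exists (2 * (1 + K))^-1; rewrite ?invr_gt0// mulVf ?lt0r_neq0.
have etaK : eta * K <= 2^-1 by clear w_le; nra.
have eta_le : eta <= 2^-1 by clear w_le; nra.
(* The decay rate is a multiple of [q = w ^ 2 / m]; stating it as [q * m = w ^ 2] keeps the
   inequalities polynomial. *)
have [q q_m] : exists q, q * m = w ^+ 2 by exists (w ^+ 2 / m); rewrite mulfVK.
have q_ge0 : 0 <= q by rewrite -(pmulr_lge0 _ m_gt0) q_m sqr_ge0.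
have q_le : q <= K * m by rewrite -(ler_pM2r m_gt0) q_m -mulrA -expr2.
have rateE : w ^+ 2 / (4 * (1 + K) * m) = eta * q / 2.
  have K1_neq0 : 1 + K != 0 by rewrite lt0r_neq0// -(pmulr_rgt0 (1 + K) (ltr0Sn R 1)).
  apply: (mulIf (lt0r_neq0 K1_gt0)); rewrite -q_m; transitivity (q / 2).
    by field; rewrite mN0 K1_neq0.
  by transitivity (eta * (2 * (1 + K)) * (q / 2)); [rewrite eta_eq mul1r|ring].
have [d d_m] : exists d, d * m = eta * w by exists (eta * w / m); rewrite mulfVK.
have d_w : d * w = eta * q.
  by apply: (mulIf mN0); rewrite mulrAC d_m -!mulrA q_m expr2.
(* Here [d ^ 2 m ^ 2 = eta ^ 2 w ^ 2 <= eta (eta K) m ^ 2], and both [eta] and [eta K] are at most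
   [1/2]. *)
have d_sqr : d ^+ 2 <= 2^-1 ^+ 2.
  have : d ^+ 2 * m ^+ 2 <= 2^-1 ^+ 2 * m ^+ 2.
    rewrite -exprMn d_m exprMn (le_trans (ler_wpM2l (sqr_ge0 _) w_le))//.
    rewrite mulrA ler_wpM2r ?sqr_ge0// !expr2 -mulrA.
    by rewrite [leLHS]mulrC; apply: ler_pM; rewrite ?mulr_ge0// ltW.
  by rewrite ler_pM2r// exprn_gt0.
have d_le : -2^-1 <= d <= 2^-1.
  rewrite -ler_norml -(ler_pXn2r (n := 2)) ?nnegrE ?normr_ge0 ?invr_ge0//.
  by rewrite real_normK ?num_real.
exists d => //.
move=> a c; rewrite rateE.
have amgm : 2 * w * (a * c) <= q * c ^+ 2 + m * a ^+ 2.
  rewrite -(ler_pM2l m_gt0).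
  have : 0 <= (w * c - m * a) ^+ 2 by exact: sqr_ge0.
  have -> : m * (q * c ^+ 2 + m * a ^+ 2) = w ^+ 2 * c ^+ 2 + m ^+ 2 * a ^+ 2.
    by rewrite -q_m; ring.
  clear; lra.
have /andP[_ energy_le] := energy_bounds a c d_le.
have e1 := ler_wpM2l (mulr_ge0 (ltW eta_gt0) q_ge0) energy_le.
have e2 := ler_wpM2l (ltW eta_gt0) amgm.
have e3 := ler_wpM2r (sqr_ge0 a) (ler_wpM2l (ltW eta_gt0) q_le).
have ma : 0 <= m * a ^+ 2 by rewrite mulr_ge0 ?sqr_ge0.
have qc : 0 <= eta * (q * c ^+ 2) by rewrite (mulr_ge0 (ltW eta_gt0))// mulr_ge0 ?sqr_ge0.
have e4 := ler_wpM2r ma etaK.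
have e5 := ler_wpM2r ma eta_le.
(* After [d m = eta w] and [d w = eta q], the inequality [amgm] absorbs the mixed term, leaving at
   most [- m a ^ 2 / 2 - eta q c ^ 2]. The energy times [eta q / 2] is at most
   [3/8 m a ^ 2 + 3/4 eta q c ^ 2], which fits. *)
have -> : 2 * a * (w * c - m * a) + 2 * c * (- (w * a)) -
    2 * d * ((w * c - m * a) * c + a * (- (w * a))) =
  - (2 * m * a ^+ 2) + 2 * (d * m) * (a * c) - 2 * (d * w) * c ^+ 2 +
    2 * (d * w) * a ^+ 2 by ring.
rewrite d_m d_w; move: e1 e2 e3 e4 e5 ma qc; clear; lra.
Qed.

(** A Gronwall argument: the Lyapunov energy times [expR (rate * t)] is nonincreasing. The factor
    [3] is the ratio of the constants [3/2] and [1/2] in [energy_bounds]. *)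
Lemma damped_oscillator_decay (R : realType) (K m w : R) (x y : R -> R) :
  0 <= K -> 0 <= m -> w ^+ 2 <= K * m ^+ 2 ->
  {within `[0, +oo[, continuous x} -> {within `[0, +oo[, continuous y} ->
  (forall t : R, 0 < t -> is_derive t 1 x (w * y t - m * x t)) ->
  (forall t : R, 0 < t -> is_derive t 1 y (- (w * x t))) ->
  forall t : R, 0 <= t ->
  x t ^+ 2 + y t ^+ 2 <=
  3 * expR (- (w ^+ 2 / (4 * (1 + K) * m) * t)) * (x 0 ^+ 2 + y 0 ^+ 2).
Proof.
move=> K_ge0 m_ge0 w_le x_cont y_cont x_deriv y_deriv t t_ge0.
have [d d_le dissipation] := damped_oscillator_lyapunov K_ge0 m_ge0 w_le.
set rate := w ^+ 2 / _ in dissipation *.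
pose energy (a c : R) := a ^+ 2 + c ^+ 2 - 2 * d * (a * c).
pose F (t : R) : R := energy (x t) (y t) * expR (rate * t).
have F_deriv (u : R) : 0 < u -> is_derive u 1 F
    ((2 * x u * (w * y u - m * x u) + 2 * y u * (- (w * x u)) -
      2 * d * ((w * y u - m * x u) * y u + x u * (- (w * x u))) +
      rate * energy (x u) (y u)) * expR (rate * u)).
  move=> u0; have dx := x_deriv u u0; have dy := y_deriv u u0.
  have de : is_derive u 1 (expR \o (rate \*: id)) (rate * expR (rate * u)).
    have did : is_derive u 1 (rate \*: @id R) rate.
      by apply: is_derive_eq; rewrite scaler1.
    by rewrite mulrC; exact: (is_derive1_comp (is_derive_expR _) did).
  have -> : F = (x ^+ 2 + y ^+ 2 - (2 * d) \*: (x * y)) *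
      (expR \o (rate \*: id)) by [].
  by apply: is_derive_eq; rewrite /energy !fctE /= /GRing.scale /= !expr1;
    move: (expR _) (x u) (y u) => e a c; ring.
(* The equations hold only for positive times, so continuity up to [0] is what brings the initial
   values into the comparison. *)
have F_cont : {within `[0, t], continuous F}.
  have sub0t : `[0, t] `<=` `[0, +oo[ by apply/subset_itv.
  have xc := continuous_subspaceW sub0t x_cont.
  have yc := continuous_subspaceW sub0t y_cont.
  have ec : {within `[0, t], continuous (fun u : R => expR (rate * u))}.
    apply: continuous_subspaceT => v.
    apply: (@continuous_comp _ _ _ (fun z : R => rate * z) expR).
      exact: mulrl_continuous.
    exact: continuous_expR.
  have -> : F = (x * x + y * y - cst (2 * d) * (x * y)) *
      (fun u : R => expR (rate * u)) by [].
  move=> u; apply: continuousM; last exact: ec.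
  apply: continuousB; first apply: continuousD.
  - by apply: continuousM; exact: xc.
  - by apply: continuousM; exact: yc.
  - apply: continuousM; first exact: cst_continuous.
    by apply: continuousM; [exact: xc|exact: yc].
have F_le : F t <= F 0.
  apply: (@ler0_derive1_le_cc _ F 0 t _ _ F_cont); rewrite ?in_itv/= ?lexx ?t_ge0//.
  - by move=> u; rewrite in_itv/= => /andP[u0 _]; case: (F_deriv u u0).
  - move=> u; rewrite in_itv/= => /andP[u0 _]; rewrite derive1E.
    case: (F_deriv u u0) => _ ->.
    by rewrite mulr_le0_ge0 ?expR_ge0.
have /andP[_ E0] := energy_bounds (x 0) (y 0) d_le.
have /andP[Et _] := energy_bounds (x t) (y t) d_le.
have := ler_wpM2r (expR_ge0 (- (rate * t))) F_le.
have -> : F t * expR (- (rate * t)) = energy (x t) (y t).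
  by rewrite /F -mulrA -expRD subrr expR0 mulr1.
have -> : F 0 = energy (x 0) (y 0) by rewrite /F mulr0 expR0 mulr1.
move=> Ft; have := ler_wpM2r (expR_ge0 (- (rate * t))) E0.
move: Et Ft; rewrite /energy; clear; lra.
Qed.

(** * Trading Sobolev weight for decay in time *)

(** From [1 + z <= expR z] with [z = g w / (beta + 1)] one gets [1 + w <= A expR z], and raising to
    the power [beta] costs only [expR (beta z) <= expR (g w)]. Dividing by [beta + 1] instead of
    [beta] covers [beta = 0]. *)
Lemma powR_expR_bound (R : realType) (beta g w : R) :
  0 <= beta -> 0 < g -> 0 <= w ->
  (1 + w) `^ beta * expR (- (g * w)) <= (1 + (beta + 1) / g) `^ beta.
Proof.
move=> beta_ge0 g_gt0 w_ge0.
set A := 1 + (beta + 1) / g.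
have b1_gt0 : 0 < beta + 1 by lra.
have q_gt0 : 0 < (beta + 1) / g by rewrite divr_gt0.
have A_ge1 : 1 <= A by rewrite /A; lra.
have A_ge0 : 0 <= A by lra.
pose z := g * w / (beta + 1).
have w_le : 1 + w <= A * expR z.
  apply: (le_trans _ (ler_wpM2l A_ge0 (expR_ge1Dx z))).
  have z_ge0 : 0 <= z by rewrite divr_ge0 ?mulr_ge0// ltW.
  have -> : w = (beta + 1) / g * z by rewrite /z; field; rewrite !lt0r_neq0.
  by rewrite /A; nra.
rewrite expRN -ler_pdivlMr ?invr_gt0 ?expR_gt0// invrK.
apply: (le_trans (ge0_ler_powR beta_ge0 _ _ w_le)); rewrite ?nnegrE ?mulr_ge0 ?expR_ge0//.
  lra.
rewrite powRM ?expR_ge0// ler_wpM2l ?powR_ge0//.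
rewrite /powR gt_eqF ?expR_gt0// expRK ler_expR /z.
have -> : beta * (g * w / (beta + 1)) = g * w * (beta / (beta + 1)) by ring.
rewrite ler_piMr ?mulr_ge0 ?(ltW g_gt0)// ler_pdivrMr//; lra.
Qed.

(* With [z = (1 + m) ^ (1 + r)], [w = t / z] and
   [beta = (s - alpha) / (1 + r)], the weight [(1 + m) ^ (s - alpha)] is
   [z ^ beta] and [1 + t <= z (1 + w)]. *)
Lemma weight_decay (R : realType) (r s alpha g : R) :
  0 <= r -> alpha <= s -> 0 < g ->
  exists2 C : R, 0 < C & forall m rate t : R, 0 < m -> 0 <= t ->
    g / m `^ (1 + r) <= rate ->
    (1 + m) `^ alpha * expR (- (rate * t)) <=
    C * (1 + t) `^ (- ((s - alpha) / (1 + r))) * (1 + m) `^ s.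
Proof.
move=> r_ge0 als g_gt0; set beta := (s - alpha) / (1 + r).
have r1_gt0 : 0 < 1 + r by lra.
have beta_ge0 : 0 <= beta by rewrite divr_ge0 ?subr_ge0// ltW.
have q_gt0 : 0 < (beta + 1) / g by rewrite divr_gt0//; lra.
exists ((1 + (beta + 1) / g) `^ beta); first by rewrite powR_gt0//; lra.
move=> m rate t m_gt0 t_ge0 rate_ge.
have m1_gt0 : 0 < 1 + m by lra.
have t1_gt0 : 0 < 1 + t by lra.
set z := (1 + m) `^ (1 + r).
have z_gt0 : 0 < z by rewrite powR_gt0.
have z_ge1 : 1 <= z.
  by rewrite -(powRr0 (1 + m)) ler_powR//; lra.
(* Replacing [m] by [1 + m] weakens the lower bound on the rate but expresses it through the same
   [z] as the Sobolev weights. *)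
have rate_ge_z : g / z <= rate.
  apply: le_trans rate_ge; rewrite ler_pM2l// lef_pV2 ?posrE ?powR_gt0//.
  by rewrite ge0_ler_powR ?nnegrE//; lra.
have w_ge0 : 0 <= t / z by rewrite divr_ge0// ltW.
have key := powR_expR_bound beta_ge0 g_gt0 w_ge0.
have e_le : expR (- (rate * t)) <= expR (- (g * (t / z))).
  by rewrite mulrCA [t * _]mulrC ler_expR lerN2 ler_wpM2r.
have zw : (1 + t) `^ beta <= z `^ beta * (1 + t / z) `^ beta.
  have w1_ge0 : 0 <= 1 + t / z by lra.
  have tz : 1 + t <= z * (1 + t / z).
    by rewrite mulrDr mulr1 mulrCA divff ?lt0r_neq0// mulr1; lra.
  rewrite -powRM ?(ltW z_gt0)//; apply: (ge0_ler_powR beta_ge0 _ _ tz).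
    by rewrite nnegrE ltW.
  by rewrite nnegrE mulr_ge0// ltW.
have zbeta : z `^ beta = (1 + m) `^ (s - alpha).
  by rewrite /z -powRrM /beta; congr powR; field; rewrite lt0r_neq0.
have sE : (1 + m) `^ s = (1 + m) `^ alpha * (1 + m) `^ (s - alpha).
  by rewrite -powRD ?subrKC// (lt0r_neq0 m1_gt0) implybT.
rewrite sE powRN -zbeta.
have -> : forall a b c d : R, a * b^-1 * (c * d) = c * (a * d) / b by move=> *; ring.
rewrite -mulrA ler_wpM2l ?powR_ge0// ler_pdivlMr ?powR_gt0//.
apply: (@le_trans _ _ (expR (- (g * (t / z))) * (z `^ beta * (1 + t / z) `^ beta))).
  by rewrite ler_pM ?expR_ge0 ?powR_ge0.
by rewrite mulrCA mulrC ler_wpM2r ?powR_ge0// mulrC.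
Qed.

(** * Trigonometric test functions *)

Section trigonometric_modes.
Context {R : realType} {n : nat}.
Implicit Types (k : 'rV[int]_n) (phi : 'rV[R]_n -> R).

Lemma dotDr (x y z : 'rV[R]_n) : dot x (y + z) = dot x y + dot x z.
Proof. by rewrite /dot -big_split; apply: eq_bigr => i _; rewrite mxE mulrDr. Qed.

Lemma dotZr (c : R) (x y : 'rV[R]_n) : dot x (c *: y) = c * dot x y.
Proof. by rewrite /dot mulr_sumr; apply: eq_bigr => i _; rewrite mxE mulrCA. Qed.

Lemma dot_delta (x : 'rV[R]_n) (j : 'I_n) : dot x (delta_mx 0 j) = x 0 j.
Proof.
rewrite /dot (bigD1 j)//= mxE !eqxx mulr1 big1 ?addr0// => i ij.
by rewrite mxE (negbTE ij) andbF mulr0.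
Qed.

Lemma continuous_dot (x : 'rV[R]_n) : continuous (dot x).
Proof.
apply: (@continuous_big _ _ +%R 0 predT); first exact: add_continuous.
move=> i _ y; apply: continuousM; first exact: cst_continuous.
exact: coord_continuous.
Qed.

(** Keeping both coefficients gives a family closed under differentiation: derivatives act linearly
    on the pair [(a, c)]. *)
Definition trig_mode k (a c : R) : 'rV[R]_n -> R :=
  fun x => a * cos (dot (freq k) x) + c * sin (dot (freq k) x).

Lemma continuous_trig_mode k a c : continuous (trig_mode k a c).
Proof.
have -> : trig_mode k a c =
  cst a * (cos \o dot (freq k)) + cst c * (sin \o dot (freq k)) by [].
move=> x; apply: continuousD; apply: continuousM; try exact: cst_continuous.
  apply: continuous_comp; first exact: continuous_dot.
  exact: continuous_cos.
apply: continuous_comp; first exact: continuous_dot.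
exact: continuous_sin.
Qed.

(** Along a coordinate direction the phase is the affine function [aff], so the difference quotient
    is that of the one-variable function [line] at [0]. *)
Lemma is_derive_trig_mode k (a c : R) (x : 'rV[R]_n) (j : 'I_n) :
  is_derive x (delta_mx 0 j) (trig_mode k a c)
    (trig_mode k (c * (k 0 j)%:~R) (- (a * (k 0 j)%:~R)) x).
Proof.
pose l : R := (k 0 j)%:~R; pose d := dot (freq k) x.
pose aff : R -> R := (l \*: @id R) + cst d.
have affE h : dot (freq k) (h *: delta_mx 0 j + x) = aff h.
  by rewrite dotDr dotZr dot_delta mxE mulrC.
pose line : R -> R := a \*: (cos \o aff) + c \*: (sin \o aff).
have daff (h : R) : is_derive h 1 aff l.
  by apply: is_derive_eq; rewrite scaler1 addr0.
have dline : is_derive (0 : R) 1 line (trig_mode k (c * l) (- (a * l)) x).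
  have dcos := is_derive1_comp (is_derive_cos (aff 0)) (daff 0).
  have dsin := is_derive1_comp (is_derive_sin (aff 0)) (daff 0).
  apply: is_derive_eq; rewrite /trig_mode -/d.
  have -> : aff 0 = d by rewrite /aff fctE /= scaler0 add0r.
  by rewrite /GRing.scale /=; ring.
have quotE : (fun h : R => h^-1 *: ((trig_mode k a c \o shift x)
      (h *: delta_mx 0 j) - trig_mode k a c x)) =
    (fun h : R => h^-1 *: ((line \o shift 0) (h *: 1) - line 0)).
  apply/funext => h /=; rewrite /trig_mode affE -/d /line !fctE /=.
  by rewrite /aff !fctE /= scaler0 add0r addr0 [h%:A]mulr1.
case: dline => dl <-; apply: DeriveDef; first by rewrite /derivable quotE.
by rewrite /derive quotE.
Qed.

Lemma pderiv_trig_mode k (a c : R) (j : 'I_n) :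
  pderiv j (trig_mode k a c) =
  trig_mode k (c * (k 0 j)%:~R) (- (a * (k 0 j)%:~R)).
Proof.
by apply/funext => x; case: (is_derive_trig_mode k a c x j).
Qed.

Lemma trig_mode_periodic k (a c : R) x (j : 'I_n) :
  trig_mode k a c (x + (2 * pi) *: delta_mx 0 j) = trig_mode k a c x.
Proof.
rewrite /trig_mode dotDr dotZr dot_delta mxE.
have shiftE (z : int) (y : R) :
    (cos (y + 2 * pi * z%:~R) = cos y) * (sin (y + 2 * pi * z%:~R) = sin y).
  have nat_shift (q : nat) (v : R) :
      (cos (v + 2 * pi * q%:R) = cos v) * (sin (v + 2 * pi * q%:R) = sin v).
    have -> : 2 * pi * q%:R = pi *+ 2 *+ q :> R by rewrite mulr_natr mulr_natl.
    by rewrite (periodicn (@cosD2pi R)) (periodicn (@sinD2pi R)).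
  case: z => q; first exact: nat_shift.
  (* A negative shift is undone by the positive shift already treated. *)
  rewrite NegzE mulrNz mulrN.
  by split; rewrite -[in RHS](subrK (2 * pi * q.+1%:R) y) nat_shift.
by rewrite !shiftE.
Qed.

(** Induction on the order of smoothness with [a] and [c] generalized, since a partial derivative
    changes only these coefficients. *)
Lemma test_fun_trig_mode k (a c : R) : test_fun (trig_mode k a c).
Proof.
split; last exact: trig_mode_periodic.
move=> m; elim: m a c => [|m IHm] a c; first exact: continuous_trig_mode.
split=> [|j]; first exact: continuous_trig_mode.
split=> [x|]; first by case: (is_derive_trig_mode k a c x j).
by rewrite pderiv_trig_mode.
Qed.

Lemma transport_trig_mode (b : 'rV[R]_n) k (a c : R) :
  transport b (trig_mode k a c) =
  trig_mode k (c * dot b (freq k)) (- (a * dot b (freq k))).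
Proof.
apply/funext => x; rewrite /transport.
under eq_bigr do rewrite pderiv_trig_mode.
rewrite /trig_mode /dot !mulr_sumr -sumrN !mulr_suml -big_split/=.
by apply: eq_bigr => j _; rewrite mxE; ring.
Qed.

Lemma laplacian_trig_mode k (a c : R) :
  laplacian (trig_mode k a c) =
  trig_mode k (- (dot (freq k) (freq k) * a)) (- (dot (freq k) (freq k) * c)).
Proof.
apply/funext => x; rewrite /laplacian.
under eq_bigr do rewrite !pderiv_trig_mode.
rewrite /trig_mode {2 4}/dot !mulr_suml -!sumrN !mulr_suml -big_split/=.
by apply: eq_bigr => j _; rewrite mxE; ring.
Qed.

End trigonometric_modes.

(** * Fourier coefficients as pairings with test functions *)

Section fourier_modes.
Context {R : realType} {n : nat}.
Local Notation P := (@torus_prob R n).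
Implicit Types (k : 'rV[int]_n) (u v : tfun (R := R) (n := n)).

Lemma measurable_trig_mode k (a c : R) :
  measurable_fun setT (fun x : tpoint (R := R) n => trig_mode k a c (coords x)).
Proof.
have mdot : measurable_fun setT
    (fun x : tpoint (R := R) n => dot (freq k) (coords x)).
  rewrite /dot; apply: measurable_sum => i.
  apply: measurable_funM; first exact: measurable_cst.
  under eq_fun do rewrite mxE.
  exact: measurable_tnth.
apply: measurable_funD; apply: measurable_funM; try exact: measurable_cst.
  apply: measurableT_comp mdot; apply: continuous_measurable_fun.
  exact: continuous_cos.
apply: measurableT_comp mdot; apply: continuous_measurable_fun.
exact: continuous_sin.
Qed.

(** On a probability space [L^2] lies in [L^1], and the trigonometric factor is bounded by
    [|a| + |c|]. *)
Lemma integrable_mul_trig_mode u k (a c : R) : u \in Lfun P 2%:E ->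
  P.-integrable setT (EFin \o (fun x => u x * trig_mode k a c (coords x))).
Proof.
move=> u2.
have u1 : u \in Lfun P 1.
  by apply: Lfun_subset12 u2; exact: fin_num_measure.
apply: (@integrableMl _ _ _ P setT measurableT (EFin \o u)
  (fun x => trig_mode k a c (coords x))).
- exact/Lfun1_integrable.
- exact: measurable_trig_mode.
- exists (`|a| + `|c|); split; first exact: num_real.
  move=> M ltM x _; apply/ltW/(le_lt_trans _ ltM).
  rewrite (le_trans (ler_normD _ _))// !normrM.
  by rewrite lerD// ler_piMr// ?cos_max ?sin_max.
Qed.

Lemma pairing_trig_mode u k (a c : R) : u \in Lfun P 2%:E ->
  pairing u (trig_mode k a c) =
  a * pairing u (trig_mode k 1 0) + c * pairing u (trig_mode k 0 1).
Proof.
move=> u2; rewrite /pairing.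
have i10 := integrable_mul_trig_mode k 1 0 u2.
have i01 := integrable_mul_trig_mode k 0 1 u2.
rewrite -!RintegralZl// -RintegralD//; last 2 first.
- exact: (integrableZl measurableT a i10).
- exact: (integrableZl measurableT c i01).
by apply: eq_Rintegral => x _; rewrite /trig_mode; ring.
Qed.

(** Up to the sign of the sine part, the real and imaginary parts of the coefficient are pairings
    with test functions, to which the weak equations apply. *)
Lemma normc_fourier u k :
  Normc.normc (fourier u k) ^+ 2 =
  pairing u (trig_mode k 1 0) ^+ 2 + pairing u (trig_mode k 0 1) ^+ 2.
Proof.
rewrite /fourier /Normc.normc sqr_sqrtr ?addr_ge0 ?sqr_ge0// sqrrN.
by congr (_ ^+ 2 + _ ^+ 2); apply: eq_Rintegral => x _; rewrite /trig_mode; ring.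
Qed.

Lemma normc_fourier_ae u v k :
  measurable_fun setT u -> measurable_fun setT v ->
  {ae P, forall x, u x = v x} ->
  Normc.normc (fourier u k) ^+ 2 = Normc.normc (fourier v k) ^+ 2.
Proof.
move=> mu mv uv.
have pairE (a c : R) : pairing u (trig_mode k a c) = pairing v (trig_mode k a c).
  congr fine; apply: ae_eq_integral => //.
  - by apply/measurable_EFinP/measurable_funM => //; exact: measurable_trig_mode.
  - by apply/measurable_EFinP/measurable_funM => //; exact: measurable_trig_mode.
  - by apply: filterS uv => x /= -> _.
by rewrite !normc_fourier !pairE.
Qed.

Lemma normc_fourier0 u : \int[P]_x u x = 0 ->
  Normc.normc (fourier u 0) ^+ 2 = 0.
Proof.
have freq0 x : dot (freq (0 : 'rV[int]_n)) x = 0 :> R.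
  by rewrite /dot big1// => i _; rewrite !mxE mul0r.
move=> u0; rewrite normc_fourier /pairing.
under eq_Rintegral do rewrite /trig_mode freq0 cos0 sin0 !mulr1 mulr0 addr0 mulr1.
under [X in _ + X ^+ 2]eq_Rintegral do
  rewrite /trig_mode freq0 cos0 sin0 mul0r mulr0 addr0 mulr0.
by rewrite u0 Rintegral_cst// mul0r expr0n addr0.
Qed.

(** The entries of [k] are integers, and an integer is bounded in absolute value by its square. *)
Lemma freq_le_sqr k (i : 'I_n) : `|(k 0 i)%:~R| <= dot (freq k) (freq k) :> R.
Proof.
rewrite /dot (bigD1 i)//= mxE -[leLHS]addr0 lerD//; last first.
  by apply: sumr_ge0 => j _; rewrite -expr2 sqr_ge0.
rewrite -intrM -intr_norm ler_int; have [->//|k_neq0] := eqVneq (k 0 i) 0.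
by rewrite -expr2 -real_normK ?num_real// expr2 ler_peMr// -gtz0_ge1 normr_gt0.
Qed.

(** Supplies the hypothesis [w ^ 2 <= K m ^ 2] of the oscillator estimate with a [K] independent of
    the frequency. *)
Lemma dot_freq_le (b : 'rV[R]_n) k :
  dot b (freq k) ^+ 2 <=
  (\sum_i `|b 0 i|) ^+ 2 * dot (freq k) (freq k) ^+ 2.
Proof.
rewrite -exprMn -[leLHS]real_normK ?num_real//.
have h : `|dot b (freq k)| <= (\sum_i `|b 0 i|) * dot (freq k) (freq k).
  rewrite mulr_suml (le_trans (ler_norm_sum _ _ _))//.
  apply: ler_sum => i _; rewrite normrM ler_wpM2l// mxE.
  exact: freq_le_sqr.
by rewrite ler_pXn2r// nnegrE (le_trans _ h).
Qed.

End fourier_modes.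

(** * Decay of a single Fourier mode *)

Section decay.
Context {R : realType} {n : nat}.
Implicit Types (k : 'rV[int]_n) (b : 'rV[R]_n).

(** The oscillator rate for [w = b.k], [m = |k|^2] and [K] from [dot_freq_le]; it is [0] at
    [k = 0]. *)
Definition decay_rate b k : R :=
  dot b (freq k) ^+ 2 /
  (4 * (1 + (\sum_i `|b 0 i|) ^+ 2) * dot (freq k) (freq k)).

Lemma dot_ge0 (x : 'rV[R]_n) : 0 <= dot x x.
Proof. by apply: sumr_ge0 => i _; rewrite -expr2 sqr_ge0. Qed.

Lemma dot_freq_gt0 k : k != 0 -> 0 < dot (freq k) (freq k) :> R.
Proof.
move=> /rV0Pn[i ki]; apply: lt_le_trans (freq_le_sqr k i).
by rewrite normr_gt0 intr_eq0.
Qed.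

(** Since [|k| = m ^ (1/2)], the condition gives [w ^ 2 >= c ^ 2 / m ^ r]; dividing by [m] produces
    the exponent [1 + r]. *)
Lemma decay_rate_diophantine b r : diophantine b r ->
  exists2 g : R, 0 < g & forall k, k != 0 ->
    g / dot (freq k) (freq k) `^ (1 + r) <= decay_rate b k.
Proof.
move=> [c c_gt0 dioph]; rewrite /decay_rate.
set K := (\sum_i `|b 0 i|) ^+ 2.
have K_ge0 : 0 <= K by exact: sqr_ge0.
have K4_gt0 : 0 < 4 * (1 + K) by lra.
exists (c ^+ 2 / (4 * (1 + K))) => [|k k0]; first by rewrite divr_gt0 ?exprn_gt0.
set m := dot _ _.
have m_gt0 : 0 < m by exact: dot_freq_gt0.
have := dioph k k0; rewrite /enorm -/m -powR12_sqrt ?(ltW m_gt0)// -powRrM => h.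
have {h} : (c / m `^ (2^-1 * r)) ^+ 2 <= dot b (freq k) ^+ 2.
  by rewrite -[leRHS]real_normK ?num_real// ler_pXn2r// nnegrE divr_ge0 ?powR_ge0// ltW.
have -> : (c / m `^ (2^-1 * r)) ^+ 2 = c ^+ 2 / m `^ r.
  rewrite expr_div_n -[_ `^ _ ^+ 2]powR_mulrn ?powR_ge0// -powRrM.
  by congr (_ / _ `^ _); field.
move=> h.
rewrite powRD ?(lt0r_neq0 m_gt0) ?implybT// powRr1 ?(ltW m_gt0)//.
have -> : c ^+ 2 / (4 * (1 + K)) / (m * m `^ r) =
    c ^+ 2 / m `^ r * (4 * (1 + K) * m)^-1.
  by rewrite !invfM; ring.
by rewrite ler_wpM2r// invr_ge0 mulr_ge0// ltW.
Qed.

(** Both operators of the system act componentwise, so the energy is taken for one component and one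
    frequency. *)
Definition mode_energy (U B : vfield R n) (i : 'I_n) k : R :=
  Normc.normc (fourier (component U i) k) ^+ 2 +
  Normc.normc (fourier (component B i) k) ^+ 2.

(* The cosine mode of [U] is coupled with the sine mode of [B] and conversely. *)
Lemma mode_energy_decay b (U B : R -> vfield R n) :
  (forall t : R, 0 <= t -> L2field (U t) /\ L2field (B t)) ->
  weakly_continuous U -> weakly_continuous B ->
  weak_eq 1 b U B -> weak_eq 0 b B U ->
  forall i k t, 0 <= t ->
    mode_energy (U t) (B t) i k <=
    3 * expR (- (decay_rate b k * t)) * mode_energy (U 0) (B 0) i k.
Proof.
move=> UB2 Uc Bc Ueq Beq i k t t_ge0.
pose u a c (tau : R) := pairing (component (U tau) i) (trig_mode k a c).
pose v a c (tau : R) := pairing (component (B tau) i) (trig_mode k a c).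
set w := dot b (freq k); set m := dot (freq k) (freq k) : R.
have u_deriv (a c tau : R) : 0 < tau -> is_derive tau 1 (u a c)
    (- m * (a * u 1 0 tau + c * u 0 1 tau) -
     w * (c * v 1 0 tau - a * v 0 1 tau)).
  move=> tau0; have [U2 B2] := UB2 tau (ltW tau0).
  apply: (is_derive_eq (Ueq i (trig_mode k a c) (test_fun_trig_mode k a c) tau tau0)).
  rewrite laplacian_trig_mode transport_trig_mode -/w -/m.
  rewrite (pairing_trig_mode k (- _) _ (U2 i)) (pairing_trig_mode k _ (- _) (B2 i)).
  by rewrite -/(u 1 0 tau) -/(u 0 1 tau) -/(v 1 0 tau) -/(v 0 1 tau); ring.
have v_deriv (a c tau : R) : 0 < tau -> is_derive tau 1 (v a c)
    (- w * (c * u 1 0 tau - a * u 0 1 tau)).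
  move=> tau0; have [U2 B2] := UB2 tau (ltW tau0).
  apply: (is_derive_eq (Beq i (trig_mode k a c) (test_fun_trig_mode k a c) tau tau0)).
  rewrite mul0r transport_trig_mode -/w.
  rewrite (pairing_trig_mode k _ (- _) (U2 i)).
  by rewrite -/(u 1 0 tau) -/(u 0 1 tau); ring.
have u_cont a c : {within `[0, +oo[, continuous (u a c)}.
  exact: Uc (test_fun_trig_mode k a c).
have v_cont a c : {within `[0, +oo[, continuous (v a c)}.
  exact: Bc (test_fun_trig_mode k a c).
have K_ge0 : 0 <= (\sum_i `|b 0 i|) ^+ 2 :> R by exact: sqr_ge0.
have m_ge0 : 0 <= m by exact: dot_ge0.
have w_le := dot_freq_le b k.
(* The second oscillator has [- w] in place of [w]; its rate is the same, depending only on
   [w ^ 2]. *)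
have Nw_le : (- w) ^+ 2 <= (\sum_i `|b 0 i|) ^+ 2 * m ^+ 2 by rewrite sqrrN.
have u10 (tau : R) : 0 < tau ->
    is_derive tau 1 (u 1 0) (w * v 0 1 tau - m * u 1 0 tau).
  by move=> h; apply: (is_derive_eq (u_deriv 1 0 tau h)); ring.
have v01 (tau : R) : 0 < tau -> is_derive tau 1 (v 0 1) (- (w * u 1 0 tau)).
  by move=> h; apply: (is_derive_eq (v_deriv 0 1 tau h)); ring.
have u01 (tau : R) : 0 < tau ->
    is_derive tau 1 (u 0 1) (- w * v 1 0 tau - m * u 0 1 tau).
  by move=> h; apply: (is_derive_eq (u_deriv 0 1 tau h)); ring.
have v10 (tau : R) : 0 < tau -> is_derive tau 1 (v 1 0) (- (- w * u 0 1 tau)).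
  by move=> h; apply: (is_derive_eq (v_deriv 1 0 tau h)); ring.
have d1 := damped_oscillator_decay K_ge0 m_ge0 w_le (u_cont 1 0) (v_cont 0 1)
  u10 v01 t_ge0.
have d2 := damped_oscillator_decay K_ge0 m_ge0 Nw_le (u_cont 0 1) (v_cont 1 0)
  u01 v10 t_ge0.
rewrite sqrrN in d2.
rewrite /mode_energy !normc_fourier.
have := lerD d1 d2; rewrite -mulrDr -/(decay_rate b k) /u /v; lra.
Qed.

End decay.

(** * Summation over frequencies *)

Lemma poweR2VD_le (R : realType) (x y : \bar R) : (0 <= x)%E -> (0 <= y)%E ->
  ((x + y) `^ 2^-1 <= x `^ 2^-1 + y `^ 2^-1)%E.
Proof.
have yE : (+oo `^ 2^-1 = +oo :> \bar R)%E by rewrite poweRyr// invr_eq0.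
case: x => [x||]//; case: y => [y||]// x0 y0; last 3 first.
- by rewrite addey// yE addey ?leey// -ltNye (lt_le_trans _ (poweR_ge0 _ _)).
- by rewrite addye// yE addye ?leey// -ltNye (lt_le_trans _ (poweR_ge0 _ _)).
- by rewrite yE addye ?leey.
rewrite !lee_fin in x0 y0.
rewrite -EFinD !poweR_EFin -EFinD lee_fin !powR12_sqrt ?addr_ge0//.
rewrite -(ler_pXn2r (n := 2)) ?nnegrE ?addr_ge0 ?sqrtr_ge0//.
rewrite sqrrD !sqr_sqrtr ?addr_ge0//.
have := mulr_ge0 (sqrtr_ge0 x) (sqrtr_ge0 y); lra.
Qed.

Lemma esumZl_le (R : realType) (T : choiceType) (c : R) (a : T -> \bar R) :
  0 <= c -> (forall x, 0 <= a x)%E ->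
  (\esum_(x in [set: T]) (c%:E * a x) <= c%:E * \esum_(x in [set: T]) a x)%E.
Proof.
move=> c0 a0; apply: ge_ereal_sup => _ [A [finA _] <-].
rewrite -ge0_mule_fsumr//; apply: lee_wpmul2l; first by rewrite lee_fin.
by apply: esum_ge; exists A.
Qed.

Section energy_comparison.
Context {R : realType} {n : nat}.
Implicit Types (U B : vfield R n) (k : 'rV[int]_n).

(** The evolution exchanges energy between [U] and [B], so modes are compared jointly. Each of the
    two norms is at most the root of the joint sum, whence the factor [2], and subadditivity of the
    root separates the data. *)
Lemma Hnorm_sum_le (D alpha s : R) U B U0 B0 : 0 <= D ->
  (forall k,
    (1 + enorm (freq (R := R) k) ^+ 2) `^ alpha * \sum_i mode_energy U B i k <=
    D * ((1 + enorm (freq (R := R) k) ^+ 2) `^ s *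
         \sum_i mode_energy U0 B0 i k)) ->
  (Hnorm alpha U + Hnorm alpha B <=
   (2 * Num.sqrt D)%:E * (Hnorm s U0 + Hnorm s B0))%E.
Proof.
move=> D_ge0 mode_le.
pose S (a : R) (V : vfield R n) : \bar R := (\esum_(k in [set: 'rV[int]_n])
  ((1 + enorm (freq (R := R) k) ^+ 2) `^ a *
    \sum_(i < n) Normc.normc (fourier (component V i) k) ^+ 2)%:E)%E.
have S_term (a : R) V k : 0 <= (1 + enorm (freq (R := R) k) ^+ 2) `^ a *
    \sum_(i < n) Normc.normc (fourier (component V i) k) ^+ 2.
  by rewrite mulr_ge0 ?powR_ge0// sumr_ge0// => i _; exact: sqr_ge0.
have S_ge0 a V : (0 <= S a V)%E by apply: esum_ge0 => k _; rewrite lee_fin.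
have S_le : (S alpha U + S alpha B <= D%:E * (S s U0 + S s B0))%E.
  rewrite -!esumD; try by move=> k _; rewrite lee_fin.
  apply: le_trans (esumZl_le D_ge0 _); last first.
    by move=> k; rewrite adde_ge0 ?lee_fin.
  apply: le_esum => k _; rewrite -!EFinD -EFinM lee_fin -!mulrDr -!big_split.
  exact: mode_le.
have half V : (S alpha V <= D%:E * (S s U0 + S s B0))%E ->
    (Hnorm alpha V <= (Num.sqrt D)%:E * (Hnorm s U0 + Hnorm s B0))%E.
  move=> h; apply: (@le_trans _ _ ((D%:E * (S s U0 + S s B0)) `^ 2^-1)%E).
    apply: gt0_ler_poweR; rewrite ?in_itv/= ?leey ?andbT ?S_ge0 ?invr_ge0//.
    by rewrite mule_ge0 ?lee_fin// adde_ge0.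
  rewrite poweRM ?lee_fin ?adde_ge0// poweR_EFin powR12_sqrt//.
  by apply: lee_wpmul2l; [rewrite lee_fin sqrtr_ge0|exact: poweR2VD_le].
rewrite mulr_natl mulr2n EFinD ge0_muleDl ?lee_fin ?sqrtr_ge0//.
apply: leeD; apply: half; apply: le_trans S_le; first exact: leeDl.
exact: leeDr.
Qed.

(** The initial condition holds only almost everywhere, which Fourier coefficients do not detect. *)
Lemma mode_energy_ae U B U0 B0 i k :
  L2field U -> L2field B -> L2field U0 -> L2field B0 ->
  {ae torus_prob n, forall x, U x = U0 x} ->
  {ae torus_prob n, forall x, B x = B0 x} ->
  mode_energy U B i k = mode_energy U0 B0 i k.
Proof.
have L2_measurable V : L2field V -> measurable_fun setT (component V i).
  by move=> /(_ i); rewrite inE => /andP[/[!inE]/=].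
move=> U2 B2 U02 B02 UU0 BB0; congr (_ + _); apply: normc_fourier_ae => //;
  try exact: L2_measurable.
- by apply: filterS UU0 => x; rewrite /component => ->.
- by apply: filterS BB0 => x; rewrite /component => ->.
Qed.

(** The case of a damped velocity, with a constant chosen before the data. *)
Lemma Hnorm_decay (r s alpha : R) (b : 'rV[R]_n) :
  0 <= r -> diophantine b r -> alpha <= s ->
  exists2 C : R, 0 < C &
    forall U0 B0 : vfield R n,
      L2field U0 -> L2field B0 -> mean_zero U0 -> mean_zero B0 ->
      forall U B : R -> vfield R n,
        solution 1 0 b U0 B0 U B ->
        forall t : R, 0 <= t ->
          (Hnorm alpha (U t) + Hnorm alpha (B t) <=
           (C * (1 + t) `^ (- ((s - alpha) / (2 * (1 + r)))))%:E *
           (Hnorm s U0 + Hnorm s B0))%E.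
Proof.
move=> r_ge0 b_dioph als.
have [g g_gt0 rate_ge] := decay_rate_diophantine b_dioph.
have [C C_gt0 weight_le] := weight_decay r_ge0 als g_gt0.
exists (2 * Num.sqrt (3 * C)); first by rewrite mulr_gt0// sqrtr_gt0 mulr_gt0.
move=> U0 B0 U02 B02 U0m B0m U B [UB2 [Uc Bc] Ueq Beq _ [UU0 BB0]] t t_ge0.
have E_init i k : mode_energy (U 0) (B 0) i k = mode_energy U0 B0 i k.
  by have [] := UB2 0 (lexx _) => U2 B2; exact: mode_energy_ae.
set p := (s - alpha) / (2 * (1 + r)).
have pE : (s - alpha) / (1 + r) = 2 * p.
  by rewrite /p; field; rewrite lt0r_neq0//; lra.
(* The squared norms decay with exponent [2 p]; taking roots halves it. The [3] comes from the
   oscillator and the [C] from [weight_decay]. *)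
have -> : 2 * Num.sqrt (3 * C) * (1 + t) `^ (- p) =
    2 * Num.sqrt (3 * C * (1 + t) `^ (- (2 * p))).
  rewrite [in RHS]sqrtrM ?mulr_ge0 ?(ltW C_gt0)// mulrA; congr (_ * _).
  by rewrite -powR12_sqrt ?powR_ge0// -powRrM; congr powR; field.
apply: Hnorm_sum_le => [|k]; first by rewrite !mulr_ge0 ?powR_ge0// ltW.
rewrite sqr_sqrtr ?dot_ge0//; set m := dot _ _.
have E_decay i : mode_energy (U t) (B t) i k <=
    3 * expR (- (decay_rate b k * t)) * mode_energy U0 B0 i k.
  by rewrite -E_init; exact: mode_energy_decay.
have E_ge0 i : 0 <= mode_energy U0 B0 i k by rewrite addr_ge0 ?sqr_ge0.
have sum_decay : \sum_i mode_energy (U t) (B t) i k <=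
    3 * expR (- (decay_rate b k * t)) * \sum_i mode_energy U0 B0 i k.
  by rewrite mulr_sumr; apply: ler_sum.
(* The zero mode has rate [0], but its initial energy vanishes by the mean-zero condition, so it
   stays zero. *)
have [k0|kN0] := eqVneq k 0.
  have sum0 : \sum_i mode_energy U0 B0 i k = 0.
    by rewrite big1// => i _; rewrite /mode_energy k0 !normc_fourier0 ?addr0.
  move: sum_decay; rewrite sum0 !mulr0 => ?.
  by rewrite mulr_ge0_le0 ?powR_ge0.
have m_gt0 : 0 < m by exact: dot_freq_gt0.
have W := weight_le m (decay_rate b k) t m_gt0 t_ge0 (rate_ge k kN0).
rewrite -pE.
apply: (le_trans (ler_wpM2l (powR_ge0 _ _) sum_decay)).
rewrite !mulrA ler_wpM2r ?sumr_ge0//.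
by rewrite [_ * 3]mulrC -!mulrA ler_wpM2l// !mulrA.
Qed.

End energy_comparison.

Theorem theorem1p1 (R : realType) (n : nat) (r : R) (b : 'rV[R]_n)
    (mu nu s alpha : R)
    (n_ge2 : (2 <= n)%N)
    (r_gt : n%:R - 1 < r)
    (b_dioph : diophantine b r)
    (mu_nu : (mu = 1 /\ nu = 0) \/ (mu = 0 /\ nu = 1))
    (s_ge0 : 0 <= s)
    (alpha_ge0 : 0 <= alpha)
    (alpha_le_s : alpha <= s) :
  exists2 C : R, 0 < C &
    forall U0 B0 : vfield R n,
      Hspace s U0 -> Hspace s B0 ->
      div_free U0 -> div_free B0 ->
      mean_zero U0 -> mean_zero B0 ->
      forall U B : R -> vfield R n,
        solution mu nu b U0 B0 U B ->
        forall t : R, 0 <= t ->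
          (Hnorm alpha (U t) + Hnorm alpha (B t) <=
           (C * (1 + t) `^ (- ((s - alpha) / (2 * (1 + r)))))%:E *
           (Hnorm s U0 + Hnorm s B0))%E.
Proof.
have r_ge0 : 0 <= r.
  by rewrite (le_trans _ (ltW r_gt))// subr_ge0 ler1n (leq_trans _ n_ge2).
have [C C_gt0 decay] := Hnorm_decay r_ge0 b_dioph alpha_le_s.
exists C => // U0 B0 [U02 _] [B02 _] _ _ U0m B0m U B sol t t_ge0.
case: mu_nu => -[mu_eq nu_eq]; rewrite mu_eq nu_eq in sol.
  exact: decay.
(* Exchanging [U] and [B] exchanges the two viscosities. *)
rewrite addeC [(Hnorm s U0 + _)%E]addeC; apply: decay => //.
case: sol => UB2 [Uc Bc] Ueq Beq UBdiv [UU0 BB0].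
by split=> // tau tau0; [case: (UB2 tau tau0)|case: (UBdiv tau tau0)].
Qed.
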